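(* Let $H^{(0)}$ be the Bannai-Ito operator with real parameters $\rho_1,\rho_2,r_1,r_2$, and let $H^{(n)}$, $\mathcal F^{(n)}$, $\mathcal B^{(n)}$ ($n\ge1$) be the $n$-step exceptional Bannai-Ito operators and the associated operators obtained by iterating the generalized Darboux transformation (as defined in the context). Then for $n=1,2,\ldots$, $$(\mathcal F^{(n)}\circ\cdots\circ\mathcal F^{(1)})\circ H^{(0)}=H^{(n)}\circ(\mathcal F^{(n)}\circ\cdots\circ\mathcal F^{(1)}),$$ $$H^{(0)}\circ(\mathcal B^{(1)}\circ\cdots\circ\mathcal B^{(n)})=(\mathcal B^{(1)}\circ\cdots\circ\mathcal B^{(n)})\circ H^{(n)}.$$
   Context: The operators act on functions of $x$ by $R[f(x)]=f(-x)$, $T[f(x)]=f(x+1)$, $I[f(x)]=f(x)$, so $TR[f(x)]=f(-x-1)$. A function standing to the left or right of an operator denotes multiplication by that function; products are compositions. Functions are taken in a field of functions of $x$ containing the rational functions and closed under $x\mapsto -x$, $x\mapsto x+1$ (for example meromorphic functions). Bannai-Ito operator: $H^{(0)}=H=\alpha^{(0)}(x)(R-I)+\beta^{(0)}(x)(TR-I)$, $\gamma^{(0)}=0$, with $$\alpha^{(0)}(x)=\frac{(x-\rho_1)(x-\rho_2)}{-2x},\qquad \beta^{(0)}(x)=\frac{(x-r_1+1/2)(x-r_2+1/2)}{2x+1}.$$ Iteration. Let $\phi^{(1)}_1,\phi^{(1)}_2,\ldots$ be eigenfunctions of $H^{(0)}$ with pairwise distinct eigenvalues $\mu_1,\mu_2,\ldots$.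 For $n\ge1$, given $H^{(n-1)}=\alpha^{(n-1)}(x)(R-I)+\beta^{(n-1)}(x)(TR-I)+\gamma^{(n-1)}(x)$, the $n$-th seed solution is $\phi^{(n)}_n=\mathcal F^{(n-1)}\circ\cdots\circ\mathcal F^{(1)}[\phi^{(1)}_n]$ (an eigenfunction of $H^{(n-1)}$ with eigenvalue $\mu_n$), and $$\chi^{(n)}(x)=\phi^{(n)}_n(x)-\phi^{(n)}_n(-x),\qquad \tilde\chi^{(n)}(x)=\beta^{(n-1)}(-x-1)\phi^{(n)}_n(x)+\beta^{(n-1)}(x)\phi^{(n)}_n(-x-1),$$ assumed not identically zero; $$\mathcal F^{(n)}=\frac1{\chi^{(n)}(x)}(R-I)+\frac1{\tilde\chi^{(n)}(x)}(TR+I)\beta^{(n-1)}(-x-1),$$ $$\mathcal B^{(n)}=\alpha^{(n-1)}(x)(R-I)\tilde\chi^{(n)}(x)+(TR+I)\alpha^{(n-1)}(x)\beta^{(n-1)}(-x-1)\chi^{(n)}(x).$$ The $n$-step exceptional Bannai-Ito operator is $H^{(n)}=\alpha^{(n)}(x)(R-I)+\beta^{(n)}(x)(TR-I)+\gamma^{(n)}(x)$ with $$\alpha^{(n)}(x)=\frac{\tilde\chi^{(n)}(-x)}{\chi^{(n)}(x)},\quad \beta^{(n)}(x)=\frac{\alpha^{(n-1)}(-x-1)\beta^{(n-1)}(x)\chi^{(n)}(-x-1)}{\tilde\chi^{(n)}(x)},\quad \gamma^{(n)}(x)=\frac{\tilde\chi^{(n)}(-x)-\tilde\chi^{(n)}(x)}{\chi^{(n)}(x)}+\gamma^{(n-1)}(x).$$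 *)

(* Defs.v *)
From HB Require Import structures.
From mathcomp Require Import all_boot all_order all_algebra.
From mathcomp Require Export reals.

Set Implicit Arguments.
Unset Strict Implicit.
Unset Printing Implicit Defensive.

Import GRing.Theory.
Local Open Scope ring_scope.

(* A field of functions of one variable x, with field of constants C, that    *)
(* contains the rational functions C(x) and is closed under x |-> - x and     *)
(* x |-> x + 1. Meromorphic functions have no value at their poles, so these  *)
(* two substitutions are recorded through their action on the field:          *)
(*   reflection f = f(- x)  and  translation f = f(x + 1).                    *)
(* They are ring morphisms, determined on C(x) by their values on constants   *)
(* and on x. The last two fields hold because the substitutions x |-> - x and *)
(* x |-> - x - 1 are involutions; they imply that translation is bijective.   *)
Record functionField (C : fieldType) := FunctionField {
  functionField_sort :> fieldType;
  ratfun : {rmorphism {fraction {poly C}} -> functionField_sort};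
  reflection : {rmorphism functionField_sort -> functionField_sort};
  translation : {rmorphism functionField_sort -> functionField_sort};
  reflection_const : forall c : C,
    reflection (ratfun (tofrac c%:P)) = ratfun (tofrac c%:P);
  translation_const : forall c : C,
    translation (ratfun (tofrac c%:P)) = ratfun (tofrac c%:P);
  reflection_var :
    reflection (ratfun (tofrac 'X)) = - ratfun (tofrac 'X);
  translation_var :
    translation (ratfun (tofrac 'X)) = ratfun (tofrac 'X) + 1;
  reflection_involutive : involutive reflection;
  translation_reflection_involutive :
    involutive (translation \o reflection)
}.

(* The operator alpha (R - I) + beta (TR - I) + gamma, by its coefficients. *)
Record opCoefs (K : Type) := OpCoefs { alpha : K; beta : K; gamma : K }.

Section Operators.

Variables (C : fieldType) (K : functionField C).

Definition cst (c : C) : K := ratfun K (tofrac c%:P).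
Definition var : K := ratfun K (tofrac 'X).

Definition opI : K -> K := id.
Definition opR : K -> K := reflection K.
Definition opT : K -> K := translation K.
Definition opTR : K -> K := opT \o opR.
Definition opM (a : K) : K -> K := fun f => a * f.

Definition op_of (h : opCoefs K) : K -> K :=
  (opM (alpha h) \o (opR \- opI)) \+ (opM (beta h) \o (opTR \- opI))
    \+ opM (gamma h).

Definition eigenfunction (H : K -> K) (f : K) (m : C) : Prop :=
  f != 0 /\ H f = cst m * f.

Definition bannai_ito (rho1 rho2 r1 r2 : C) : opCoefs K :=
  {| alpha := (var - cst rho1) * (var - cst rho2) / (- (2 * var));
     beta := (var - cst r1 + 2^-1) * (var - cst r2 + 2^-1) / (2 * var + 1);
     gamma := 0 |}.

(* One generalized Darboux transformation of the operator with coefficients h *)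
(* and seed solution f; opTR g is the function g(- x - 1).                    *)

Definition darboux_chi (f : K) : K := f - opR f.

Definition darboux_chit (h : opCoefs K) (f : K) : K :=
  opTR (beta h) * f + beta h * opTR f.

Definition darbouxF (h : opCoefs K) (f : K) : K -> K :=
  (opM (1 / darboux_chi f) \o (opR \- opI))
    \+ (opM (1 / darboux_chit h f) \o (opTR \+ opI) \o opM (opTR (beta h))).

Definition darbouxB (h : opCoefs K) (f : K) : K -> K :=
  (opM (alpha h) \o (opR \- opI) \o opM (darboux_chit h f))
    \+ ((opTR \+ opI)
        \o opM (alpha h * opTR (beta h) * darboux_chi f)).

Definition darboux_coefs (h : opCoefs K) (f : K) : opCoefs K :=
  let chi := darboux_chi f in
  let chit := darboux_chit h f in
  {| alpha := opR chit / chi;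
     beta := opTR (alpha h) * beta h * opTR chi / chit;
     gamma := (opR chit - chit) / chi + gamma h |}.

(* The coefficients of H^(n) together with F^(n) o ... o F^(1). The seed of   *)
(* step n is built from phi n, so phi is used from index 1 on.                *)
Fixpoint darboux_chain (h0 : opCoefs K) (phi : nat -> K) (n : nat) :
    opCoefs K * (K -> K) :=
  match n with
  | 0 => (h0, opI)
  | m.+1 =>
      let: (h, Fs) := darboux_chain h0 phi m in
      let f := Fs (phi m.+1) in
      (darboux_coefs h f, darbouxF h f \o Fs)
  end.

Section Iteration.

Variables (h0 : opCoefs K) (phi : nat -> K).

Definition coefs_iter (n : nat) : opCoefs K := (darboux_chain h0 phi n).1.
Definition H_iter (n : nat) : K -> K := op_of (coefs_iter n).

Definition F_comp (n : nat) : K -> K := (darboux_chain h0 phi n).2.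

(* The objects of step n below are meaningful for n >= 1 only. *)
Definition seed (n : nat) : K := F_comp n.-1 (phi n).
Definition chi_iter (n : nat) : K := darboux_chi (seed n).
Definition chit_iter (n : nat) : K :=
  darboux_chit (coefs_iter n.-1) (seed n).
Definition F_iter (n : nat) : K -> K :=
  darbouxF (coefs_iter n.-1) (seed n).
Definition B_iter (n : nat) : K -> K :=
  darbouxB (coefs_iter n.-1) (seed n).

Lemma F_compS (n : nat) : F_comp n.+1 = F_iter n.+1 \o F_comp n.
Proof.
rewrite /F_iter /seed /F_comp /coefs_iter /=.
by case: (darboux_chain h0 phi n).
Qed.

Lemma coefs_iterS (n : nat) :
  coefs_iter n.+1 = darboux_coefs (coefs_iter n) (seed n.+1).
Proof.
rewrite /seed /F_comp /coefs_iter /=.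
by case: (darboux_chain h0 phi n).
Qed.

(* B^(1) o ... o B^(n) *)
Fixpoint B_comp (n : nat) : K -> K :=
  match n with
  | 0 => opI
  | m.+1 => B_comp m \o B_iter m.+1
  end.

End Iteration.

End Operators.

Arguments bannai_ito {C} K rho1 rho2 r1 r2.

(* Main.v *)
Require Import Defs.
From mathcomp Require Import all_boot all_order all_algebra.
From HB Require Import structures.
From mathcomp Require Import ring.
Import GRing.Theory.
Local Open Scope ring_scope.

(** The substitutions R : x |-> -x and TR : x |-> -x - 1 are involutive field
automorphisms generating an infinite dihedral group. Call an element of the
field invariant if both fix it (constants are), and call an operator
alpha (R - I) + beta (TR - I) + gamma admissible if alpha + R[alpha],
beta + TR[beta] and gamma are invariant. The Bannai-Ito operator is admissible:
the two traces are the constants rho1 + rho2 and - (r1 + r2).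

The proof is that, for an admissible operator and a solution f of its eigenvalue
equation with nonzero chi and chit, the two intertwining relations of one
Darboux step hold, and that its outcome is admissible again. In the eigenvalue
equation, rewritten as
  alpha chi = chit - (m - gamma + beta + TR[beta]) f   (seed_relation),
the factor in front of f is invariant. Applying R and eliminating f gives
  gamma1 = 2 gamma - m - (alpha + R[alpha]) - (beta + TR[beta]),
and applying TR and eliminating f gives
  beta1 + TR[beta1] = gamma - m;
moreover alpha1 + R[alpha1] = gamma1 - gamma holds because R[chi] = - chi.
The three quantities for the new operator are therefore invariant. The same
identities are all that is needed to compare, on both sides of F H = H1 F and
H B = B H1, the coefficients of 1, R, TR, R TR and TR R.

For the iteration, F commutes with multiplication by invariants, so F maps
an eigenfunction of the old operator to a solution of the eigenvalue equation
of the new one, with the same eigenvalue; thus every seed solution meets the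
hypothesis of the one-step result, and the intertwining relations compose. *)

(** * The two involutions and admissible operators *)

Section Darboux.
Variables (C : fieldType) (K : functionField C).
Local Notation r := (@opR C K).
Local Notation s := (@opTR C K).

HB.instance Definition _ := GRing.RMorphism.copy r (reflection K).
HB.instance Definition _ :=
  GRing.RMorphism.copy s (translation K \o reflection K).

(** Expanding rules whose right-hand sides show the bare maps, so that rewriting
with facts about them can follow at once. *)
Lemma opR_morph :
  ({morph r : a b / (a + b)%R} * {morph r : a b / (a * b)%R}
   * {morph r : a / (- a)%R} * {morph r : a / (a^-1)%R} * (r 1 = 1)%R)%type.
Proof.
by repeat split; move=> *;
  rewrite (rmorphD, rmorphM, rmorphN, fmorphV, rmorph1).
Qed.

Lemma opTR_morph :
  ({morph s : a b / (a + b)%R} * {morph s : a b / (a * b)%R}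
   * {morph s : a / (- a)%R} * {morph s : a / (a^-1)%R} * (s 1 = 1)%R)%type.
Proof.
by repeat split; move=> *;
  rewrite (rmorphD, rmorphM, rmorphN, fmorphV, rmorph1).
Qed.

Lemma opRK : involutive r.
Proof. exact: reflection_involutive. Qed.

Lemma opTRK : involutive s.
Proof. exact: translation_reflection_involutive. Qed.

Definition dihedral_invariant (c : K) : Prop := r c = c /\ s c = c.

Lemma cst_invariant (c : C) : dihedral_invariant (cst K c).
Proof.
rewrite /dihedral_invariant /opTR /opT /opR /cst /=.
by rewrite reflection_const translation_const.
Qed.

(** What survives of the Bannai-Ito operator under Darboux steps: its
coefficients become arbitrary functions, but these three combinations still
behave like
constants towards R and TR. *)
Record admissible (h : opCoefs K) : Prop := Admissible {
  alpha_trace : dihedral_invariant (alpha h + r (alpha h));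
  beta_trace : dihedral_invariant (beta h + s (beta h));
  gamma_invariant : dihedral_invariant (gamma h)
}.

Lemma darbouxF_linear (h : opCoefs K) (f c g : K) :
  dihedral_invariant c -> darbouxF h f (c * g) = c * darbouxF h f g.
Proof.
move=> [cr cs]; rewrite /darbouxF /opM /opI /= !rmorphM /= cr cs.
ring.
Qed.

(** * One Darboux step *)

Section Step.

(* The functions chi and chit enter as variables with defining equations, not
   by their expressions in f: conversion would see a difference and a sum in
   those, and opR_morph and opTR_morph would distribute over them. *)
Variables (h : opCoefs K) (f m chi chit : K).
Hypotheses (chi_def : darboux_chi f = chi) (chit_def : darboux_chit h f = chit).
Hypotheses (chi0 : chi != 0) (chit0 : chit != 0).
Hypotheses (hadm : admissible h) (minv : dihedral_invariant m).
Hypothesis Hf : op_of h f = m * f.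
Local Notation h1 := (darboux_coefs h f).

Lemma opR_chi : r chi = - chi.
Proof. by rewrite -chi_def /darboux_chi rmorphB /= opRK opprB. Qed.

Lemma opTR_chit : s chit = chit.
Proof.
by rewrite -chit_def /darboux_chit rmorphD /= !rmorphM /= !opTRK; ring.
Qed.

Lemma darboux_coefsE :
  h1 = {| alpha := r chit / chi;
          beta := s (alpha h) * beta h * s chi / chit;
          gamma := (r chit - chit) / chi + gamma h |}.
Proof. by rewrite /darboux_coefs chi_def chit_def. Qed.

(** The eigenvalue equation sorted by chi, chit and f: the coefficient of f is
what is left of beta after chit has absorbed TR[f], and it is invariant. *)
Lemma seed_relation :
  alpha h * chi = chit - (m - gamma h + (beta h + s (beta h))) * f.
Proof.
have -> : (m - gamma h + (beta h + s (beta h))) * f =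
          m * f + (beta h + s (beta h) - gamma h) * f by ring.
rewrite -Hf -chi_def -chit_def /op_of /opM /opI /= /darboux_chi /darboux_chit.
ring.
Qed.

(** Subtract seed_relation from its image under R: the multiples of f combine
to a multiple of f - R[f] = chi, which cancels. *)
Lemma darboux_gamma :
  gamma h1 = gamma h + gamma h - m - (alpha h + r (alpha h))
             - (beta h + s (beta h)).
Proof.
have [mr _] := minv; have [_ [Br _] [gr _]] := hadm.
have E := seed_relation.
move: (beta h + s (beta h)) Br E => B Br E; have := congr1 r E.
rewrite !opR_morph opR_chi Br gr mr => rE.
apply: (mulIf chi0).
have -> : gamma h1 * chi = r chit - chit + gamma h * chi.
  by rewrite darboux_coefsE /=; field.
have -> : r chit = (m - gamma h + B) * r f - r (alpha h) * chi.
  by rewrite -[LHS](subrK ((m - gamma h + B) * r f)) -rE; ring.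
have -> : chit = alpha h * chi + (m - gamma h + B) * f by rewrite E; ring.
rewrite -chi_def /darboux_chi; ring.
Qed.

(** Multiplied by chit, the left-hand side only involves alpha chi and its image
under TR; by seed_relation it equals (beta + TR[beta]) chit minus an invariant
multiple of beta TR[f] + TR[beta] f = chit. *)
Lemma darboux_beta_trace : beta h1 + s (beta h1) = gamma h - m.
Proof.
have [_ ms] := minv; have [_ [_ Bs] [_ gs]] := hadm.
have E := seed_relation.
apply: (mulIf chit0).
have -> : (beta h1 + s (beta h1)) * chit =
          beta h * (s (alpha h) * s chi) + s (beta h) * (alpha h * chi).
  by rewrite darboux_coefsE /= !opTR_morph opTR_chit !opTRK; field.
have sE : s (alpha h) * s chi =
          chit - (m - gamma h + (beta h + s (beta h))) * s f.
  rewrite -opTR_morph E; move: (beta h + s (beta h)) Bs => B Bs.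
  by rewrite !opTR_morph opTR_chit Bs gs ms.
by rewrite E sE -chit_def /darboux_chit; ring.
Qed.

Lemma darboux_alpha_trace :
  alpha h1 + r (alpha h1) = gamma h1 - gamma h.
Proof.
rewrite darboux_coefsE /= !opR_morph opRK opR_chi.
by field; rewrite oppr_eq0 chi0.
Qed.

Lemma darboux_admissible : admissible h1.
Proof.
have [[Ar As] [Br Bs] [gr gs]] := hadm; have [mr ms] := minv.
have g1 : dihedral_invariant (gamma h1).
  rewrite darboux_gamma.
  move: (alpha h + _) (beta h + _) Ar As Br Bs => A B Ar As Br Bs.
  by split; rewrite ?opR_morph ?opTR_morph ?(Ar, As, Br, Bs, gr, gs, mr, ms).
split=> //; case: g1 => g1r g1s.
  rewrite darboux_alpha_trace.
  move: (gamma h1) g1r g1s => c g1r g1s.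
  by split; rewrite ?opR_morph ?opTR_morph ?(g1r, g1s, gr, gs).
rewrite darboux_beta_trace.
by split; rewrite ?opR_morph ?opTR_morph ?(gr, gs, mr, ms).
Qed.

(** Here the eigenvalue and the trace of alpha are eliminated with the help of
the formulas above. Together with the next three lemmas this leaves
quantities between which no relation is needed, so that the intertwining
relations become identities of rational functions in them. *)
Lemma opR_alpha :
  r (alpha h) = (s (alpha h) * beta h * s chi + alpha h * s (beta h) * chi)
                  / chit
                - (beta h + s (beta h)) - (r chit - chit) / chi - alpha h.
Proof.
have Eg := darboux_gamma; have Eb := darboux_beta_trace.
rewrite darboux_coefsE /= !opTR_morph !opTRK opTR_chit in Eg Eb.
have -> : r (alpha h) =
  (gamma h - m) - (beta h + s (beta h))
  - ((r chit - chit) / chi + gamma h - gamma h) - alpha h.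
  by rewrite Eg; ring.
by rewrite -Eb; field; apply/andP.
Qed.

Lemma opR_opTR_beta : r (s (beta h)) = beta h + s (beta h) - r (beta h).
Proof. by rewrite -(beta_trace _ hadm).1 opR_morph; ring. Qed.

(** Invariance of gamma1 under TR. *)
Lemma opTR_opR_chit : s (r chit) = chit + (r chit - chit) / chi * s chi.
Proof.
have [_ gs] := gamma_invariant _ hadm.
have [_ g1s] := gamma_invariant _ darboux_admissible.
have sc0 : s chi != 0 by rewrite fmorph_eq0.
move: g1s; rewrite darboux_coefsE /= !opTR_morph opTR_chit gs => /addIr <-.
by field.
Qed.

(** The image under R of the trace relation for beta1, multiplied by R[chit];
it is the only relation that the coefficient of R in H B = B H1 needs besides
those above. *)
Lemma opR_darboux_beta :
  r (s (alpha h)) * r (beta h) * r (s chi) =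
  (s (alpha h) * beta h * s chi + alpha h * s (beta h) * chi) / chit * r chit
  + r (alpha h) * r (s (beta h)) * chi.
Proof.
have [mr _] := minv; have [gr _] := gamma_invariant _ hadm.
have E := darboux_beta_trace.
rewrite darboux_coefsE /= !opTR_morph !opTRK opTR_chit -mulrDl in E.
have rE := congr1 r E; rewrite !opR_morph opR_chi gr mr in rE.
rewrite E -rE.
by field; rewrite fmorph_eq0.
Qed.

Lemma darbouxF_intertwines :
  darbouxF h f \o op_of h =1 op_of h1 \o darbouxF h f.
Proof.
move=> g.
have [_ _ [gr gs]] := hadm.
have rchit0 : r chit != 0 by rewrite fmorph_eq0.
have schi0 : s chi != 0 by rewrite fmorph_eq0.
rewrite /darbouxF chi_def chit_def /op_of /opM /opI darboux_coefsE /=.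
rewrite !(opR_morph, opTR_morph, opRK, opTRK) opR_chi opTR_chit gr gs.
rewrite opR_alpha opR_opTR_beta.
field.
by rewrite oppr_eq0 chi0 chit0 rchit0 schi0.
Qed.

Lemma darbouxB_intertwines :
  op_of h \o darbouxB h f =1 darbouxB h f \o op_of h1.
Proof.
move=> g.
have [_ _ [gr gs]] := hadm.
have rchit0 : r chit != 0 by rewrite fmorph_eq0.
have schi0 : s chi != 0 by rewrite fmorph_eq0.
rewrite /darbouxB chi_def chit_def /op_of /opM /opI darboux_coefsE /=.
rewrite !(opR_morph, opTR_morph, opRK, opTRK) !(opR_chi, opTR_chit) gr gs.
rewrite opR_darboux_beta opTR_opR_chit opR_alpha opR_opTR_beta.
field.
by rewrite oppr_eq0 chi0 chit0 schi0.
Qed.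

End Step.

(** * The Bannai-Ito operator *)

Lemma opR_var : r (var K) = - var K.
Proof. exact: reflection_var. Qed.

Lemma opTR_var : s (var K) = - var K - 1.
Proof.
by rewrite /opTR /opT /opR /var /= reflection_var rmorphN translation_var opprD.
Qed.

(** In the variable y = x for alpha and R, and y = x + 1/2 for beta and TR, the
coefficient is a quadratic polynomial divided by a multiple of y, and the
involution is y |-> -y. The trace thus keeps only the quotient of the linear
term, which is a constant. *)
Lemma bannai_ito_admissible (rho1 rho2 r1 r2 : C) :
  (2 : K) != 0 -> admissible (bannai_ito K rho1 rho2 r1 r2).
Proof.
move=> two0.
(* The translation moves x by 1 and 2x + 1 by 2, hence neither is zero. *)
have var0 : var K != 0.
  apply: contra_eq_neq (translation_var K) => v0.
  by rewrite -/(var K) v0 rmorph0 add0r eq_sym oner_neq0.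
have var20 : 2 * var K + 1 != 0.
  apply/eqP => v0; move: (congr1 (translation K) v0).
  rewrite rmorphD rmorphM rmorph_nat rmorph1 rmorph0 translation_var.
  rewrite -/(var K) mulrDr mulr1 addrAC v0 add0r => /eqP.
  by rewrite (negPf two0).
have sum_invariant (a b : C) : dihedral_invariant (cst K a + cst K b).
  have [ar as_] := cst_invariant a; have [br bs] := cst_invariant b.
  by split; rewrite ?opR_morph ?opTR_morph ?(ar, as_, br, bs).
have opp_invariant (c : K) : dihedral_invariant c -> dihedral_invariant (- c).
  by case=> cr cs; split; rewrite ?opR_morph ?opTR_morph ?(cr, cs).
split=> /=; last by split; apply: rmorph0.
- have [a1 _] := cst_invariant rho1; have [a2 _] := cst_invariant rho2.
  rewrite !opR_morph opR_var a1 a2.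
  set lhs := (X in dihedral_invariant X).
  suff -> : lhs = cst K rho1 + cst K rho2 by apply: sum_invariant.
  rewrite /lhs; field.
  by rewrite !oppr_eq0 mulrN oppr_eq0 mulf_neq0.
- have [_ b1] := cst_invariant r1; have [_ b2] := cst_invariant r2.
  rewrite !opTR_morph opTR_var b1 b2.
  set lhs := (X in dihedral_invariant X).
  suff -> : lhs = - (cst K r1 + cst K r2).
    by apply: opp_invariant; apply: sum_invariant.
  rewrite /lhs; field.
  rewrite two0 var20 /= andbT -oppr_eq0.
  by apply: contra_neq var20 => <-; rewrite /var; ring.
Qed.

(** * Iteration *)

Section Chain.

Variables (h0 : opCoefs K) (phi m : nat -> K).
Hypothesis h0_admissible : admissible h0.
Hypothesis m_invariant : forall i, dihedral_invariant (m i).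

(** The four facts are proved together, because step n needs admissibility of
the operator reached so far, and the fact that phi (n + 1) is carried to a
solution of its eigenvalue equation: this follows from the intertwining
relation and from linearity of the composed F over the invariants. *)
Lemma darboux_chain_intertwines (n : nat) :
    (forall i, (1 <= i <= n)%N -> op_of h0 (phi i) = m i * phi i) ->
    (forall i, (1 <= i <= n)%N ->
       chi_iter h0 phi i != 0 /\ chit_iter h0 phi i != 0) ->
  [/\ admissible (coefs_iter h0 phi n),
      forall c g, dihedral_invariant c ->
        F_comp h0 phi n (c * g) = c * F_comp h0 phi n g,
      F_comp h0 phi n \o H_iter h0 phi 0 =1 H_iter h0 phi n \o F_comp h0 phi n
    & H_iter h0 phi 0 \o B_comp h0 phi n =1 B_comp h0 phi n \o H_iter h0 phi n].
Proof.
elim: n => [|n IHn] eigen nonzero; first by split.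
have le_n i : (1 <= i <= n)%N -> (1 <= i <= n.+1)%N.
  by case/andP=> -> /leqW.
have [|i /le_n|adm linF interF interB] := IHn; first by move=> i /le_n /eigen.
  exact: nonzero.
have [chi0 chit0] := nonzero n.+1 (leqnn _).
have seedE : op_of (coefs_iter h0 phi n) (seed h0 phi n.+1) =
             m n.+1 * seed h0 phi n.+1.
  rewrite /seed /= -linF // -(eigen n.+1 (leqnn _)).
  by have /= := interF (phi n.+1).
split.
- rewrite coefs_iterS.
  exact: (darboux_admissible _ _ _ _ _ (erefl _) (erefl _) chi0 chit0 adm
            (m_invariant n.+1) seedE).
- move=> c g cinv; rewrite F_compS /= linF //.
  exact: darbouxF_linear.
- move=> g; rewrite F_compS /H_iter coefs_iterS /=.
  rewrite (interF g : F_comp h0 phi n (H_iter h0 phi 0 g) = _).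
  exact: (darbouxF_intertwines _ _ _ _ _ (erefl _) (erefl _) chi0 chit0 adm
            (m_invariant n.+1) seedE).
- move=> g; rewrite [RHS]/= {2}/H_iter coefs_iterS.
  rewrite [LHS](interB (B_iter h0 phi n.+1 g)) /=; congr (B_comp h0 phi n _).
  exact: (darbouxB_intertwines _ _ _ _ _ (erefl _) (erefl _) chi0 chit0 adm
            (m_invariant n.+1) seedE).
Qed.

End Chain.

End Darboux.

Theorem corollary2p6
    (R : realType) (C : fieldType) (iota : {rmorphism R -> C})
    (K : functionField C) (rho1 rho2 r1 r2 : R)
    (mu : nat -> C) (phi : nat -> K) (n : nat) :
  let h0 := bannai_ito K (iota rho1) (iota rho2) (iota r1) (iota r2) in
  (1 <= n)%N ->
  (forall m, (1 <= m <= n)%N -> eigenfunction (op_of h0) (phi m) (mu m)) ->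
  (forall i j, (1 <= i <= n)%N -> (1 <= j <= n)%N -> i <> j -> mu i <> mu j) ->
  (forall m, (1 <= m <= n)%N ->
     chi_iter h0 phi m <> 0 /\ chit_iter h0 phi m <> 0) ->
  F_comp h0 phi n \o H_iter h0 phi 0 =1 H_iter h0 phi n \o F_comp h0 phi n /\
  H_iter h0 phi 0 \o B_comp h0 phi n =1 B_comp h0 phi n \o H_iter h0 phi n.
Proof.
move=> h0 _ eigen _ nonzero.
have two0 : (2 : K) != 0.
  rewrite -(rmorph_nat (ratfun K \o @tofrac _ \o @polyC C \o iota) 2).
  by rewrite fmorph_eq0 Num.Theory.pnatr_eq0.
have [] := @darboux_chain_intertwines C K h0 phi (fun i => cst K (mu i))
             (bannai_ito_admissible _ _ _ _ _ _ two0)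
             (fun i => cst_invariant _ _ (mu i)) n _ _ => //.
- by move=> i /eigen[].
- by move=> i /nonzero[/eqP ? /eqP].
Qed.
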